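(* Let $G$ be a finite group, and consider tropical representations in the Boolean regular representation $\mathbb{B}[G]$, i.e. $G$-invariant tropical linear spaces $T\subseteq\mathbb{B}[G]$, equivalently matroids on ground set $G$ for which left multiplication by each element of $G$ is an automorphism. Let $U_{d,G}$ denote the uniform matroid of rank $d$ on ground set $G$. (1) For any $1\le d\le|G|$, $U_{d,G}$ is a tropical representation in $\mathbb{B}[G]$. (2) The only tropical representation in $\mathbb{B}[G]$ of dimension one is the uniform matroid $U_{1,G}$, and the only one of codimension one is the uniform matroid $U_{|G|-1,G}$; both of these are realizable. (3) If $G$ is abelian with $|G|\ge2$, then $G$ is cyclic if and only if the tropical representation $U_{2,G}$ is realizable. (4) If $G\cong\mathbb{Z}_p$ is cyclic of prime order $p$, then for each $1\le d\le p$ the uniform matroid $U_{d,G}$ is realizable; moreover, these uniform matroids are the only realizable tropical representations (of dimension at least one) in $\mathbb{B}[G]$. (5) Let $p$ be an odd prime satisfying the following condition: either $2$ is a primitive root of $p$, or $p\equiv7\pmod 8$ and $2$ has order $\frac{p-1}{2}$ in $\mathbb{Z}_p^*$. Then the only two-dimensional tropical representation in $\mathbb{B}[\mathbb{Z}_p]$ is $U_{2,\mathbb{Z}_p}$.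
   Context: $\mathbb{B}=\{0,1\}$ is the Boolean semifield ($1+1=1$). The Boolean regular representation $\mathbb{B}[G]$ is the free $\mathbb{B}$-module with basis $\{e_g\}_{g\in G}$ and $G$-action $h\cdot e_g=e_{hg}$; $\mathbb{C}[G]$ is the usual regular representation with the same formula. A tropical linear space of rank (dimension) $d$ in $\mathbb{B}[G]$, $0\le d\le |G|$, is the submodule spanned by the indicator vectors of the cocircuits of a rank $d$ matroid on ground set $G$; it determines and is determined by the matroid, and the two are identified throughout. Codimension one means dimension $|G|-1$. For a linear subspace $L\subseteq\mathbb{C}[G]$ of dimension $d$, its tropicalization (for the trivial valuation $\nu:\mathbb{C}\to\mathbb{B}$, $\nu(0)=0$, $\nu(z)=1$ for $z\neq0$) is $\mathrm{trop}(L)=$ the $\mathbb{B}$-submodule of $\mathbb{B}[G]$ generated by $\{\sum_g\nu(w_g)e_g:\sum_g w_ge_g\in L\}$; it is the tropical linear space whose matroid has as bases those $d$-subsets $J\subseteq G$ for which the Plücker coordinate of $L$ indexed by $J$ is nonzero (the $d\times d$ minor with columns $J$ of a matrix whose rows are a basis of $L$). A tropical representation $T\subseteq\mathbb{B}[G]$ is realizable if $T=\mathrm{trop}(L)$ for some $G$-invariant linear subspace $L\subseteq\mathbb{C}[G]$. $\mathbb{Z}_m$ is the cyclic group of order $m$; $\mathbb{Z}_p^*$ is the multiplicative group of nonzero residues mod $p$, and ''2 is a primitive root of $p$'' means $2$ generates $\mathbb{Z}_p^*$. *)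

(* Defs.v *)
(* MathComp world *)
From HB Require Import structures.
From mathcomp Require Import boolp classical_sets reals.
From mathcomp Require Import all_boot all_order all_algebra all_fingroup.
From mathcomp Require Import all_solvable complex.

Set Implicit Arguments.
Unset Strict Implicit.
Unset Printing Implicit Defensive.

Import GRing.Theory.
Local Open Scope ring_scope.

(* An alias of bool, because bool itself already carries the ring structure of
   the field with two elements, in which 1 + 1 = 0. *)
Definition boolB : Type := bool.
HB.instance Definition _ := Finite.on boolB.
HB.instance Definition _ := GRing.isNmodule.Build boolB orbA orbC orFb.

Fact boolB_nonzero : (true : boolB) != 0.
Proof. by []. Qed.

HB.instance Definition _ := GRing.Nmodule_isComNzSemiRing.Build boolB
  andbA andbC andTb andb_orl andFb boolB_nonzero.

Fact boolB_add11 : 1 + 1 = 1 :> boolB.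
Proof. by []. Qed.

(* v : boolmod T stands for \sum_g (v g) e_g. *)
Definition boolmod (T : finType) : lSemiModType boolB := {ffun T -> boolB^o}.

Definition bspan (V : lSemiModType boolB) (A : set V) : set V :=
  smallest [set N : set V | GRing.subsemimod_closed [in N]]%classic A.

Record matroid (T : finType) := Matroid {
  bases : {set {set T}};
  bases_neq0 : bases != set0;
  bases_exchange : forall (B1 B2 : {set T}) (x : T),
    B1 \in bases -> B2 \in bases -> x \in B1 :\: B2 ->
    exists2 y, y \in B2 :\: B1 & y |: (B1 :\ x) \in bases }.

(* All bases of a matroid have the same cardinality. *)
Definition mrank (T : finType) (M : matroid T) : nat :=
  \max_(B in bases M) #|B|.

(* The minimal dependent sets of the matroid whose family of bases is Bs. *)
Definition circuits_of (T : finType) (Bs : {set {set T}}) : {set {set T}} :=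
  [set C | minset (fun X => ~~ [exists B in Bs, X \subset B]) C].

(* The bases of the dual matroid are the complements of the bases of M. *)
Definition cocircuits (T : finType) (M : matroid T) : {set {set T}} :=
  circuits_of [set ~: B | B in bases M].

Definition matroid_aut (T : finType) (M : matroid T) (f : T -> T) : Prop :=
  bijective f /\
  forall B : {set T}, (f @: B \in bases M) = (B \in bases M).

Section Uniform.
Variables (d : nat) (T : finType).

Definition unif_bases : {set {set T}} :=
  [set B : {set T} | #|B| == minn d #|T|].

Fact unif_bases_neq0 : unif_bases != set0.
Proof. by rewrite -card_gt0 card_draws bin_gt0 geq_minr. Qed.

Fact unif_bases_exchange (B1 B2 : {set T}) (x : T) :
    B1 \in unif_bases -> B2 \in unif_bases -> x \in B1 :\: B2 ->
  exists2 y, y \in B2 :\: B1 & y |: (B1 :\ x) \in unif_bases.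
Proof.
rewrite !inE => /eqP c1 /eqP c2 /andP[xB2 xB1].
have /card_gt0P[y yB] : (0 < #|B2 :\: B1|)%N.
  have e : #|B2 :\: B1| = #|B1 :\: B2|.
    apply/eqP; rewrite -(eqn_add2l #|B1 :&: B2|) cardsID setIC cardsID.
    by rewrite c1 c2.
  by rewrite e; apply/card_gt0P; exists x; rewrite inE xB2.
exists y => //; move: yB; rewrite !inE => /andP[yB1 _].
by rewrite cardsU1 !inE (negPf yB1) andbF -c1 (cardsD1 x B1) xB1.
Qed.

(* The uniform matroid of rank min(d, #|T|). *)
Definition uniform_matroid : matroid T :=
  Matroid unif_bases_neq0 unif_bases_exchange.

End Uniform.

Definition indicator (T : finType) (A : {set T}) : boolmod T :=
  [ffun x => x \in A].

Definition trop_linspace (T : finType) (M : matroid T) : set (boolmod T) :=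
  bspan [set indicator C | C in [set C | C \in cocircuits M]]%classic.

Section RegularRepresentation.
Variable gT : finGroupType.

(* The additive extension of e_g |-> e_(h * g). *)
Definition regact (S : Type) (h : gT) (v : {ffun gT -> S}) : {ffun gT -> S} :=
  [ffun g => v (h^-1 * g)%g].

Fact regact_basis (S : pzSemiRingType) (h g : gT) :
  regact h [ffun x => (x == g)%:R : S] = [ffun x => (x == (h * g)%g)%:R].
Proof.
by apply/ffunP=> x; rewrite !ffunE -(inj_eq (mulgI h)) mulKVg.
Qed.

Definition trop_rep (d : nat) (T : set (boolmod gT)) : Prop :=
  (exists2 M : matroid gT, mrank M = d & T = trop_linspace M) /\
  forall (h : gT) (v : boolmod gT), T v -> T (regact h v).

Variable R : realType.

Definition complexGA : vectType R[i] := {ffun gT -> R[i]^o}.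

Definition support_vec (w : complexGA) : boolmod gT := [ffun g => w g != 0].

Definition trop (L : {vspace complexGA}) : set (boolmod gT) :=
  bspan [set support_vec w | w in [set w | w \in L]]%classic.

Definition realizable (T : set (boolmod gT)) : Prop :=
  exists L : {vspace complexGA},
    (forall (h : gT) (w : complexGA), w \in L -> (regact h w : complexGA) \in L)
    /\ T = trop L.

End RegularRepresentation.

(* Main.v *)
(* The Boolean span of an antichain of sets determines it as the family of its
   minimal nonempty supports, and an antichain of bases is determined by its
   circuits; hence a tropical linear space determines its matroid, and
   statements about T turn into statements about bases.

   A G-invariant matroid of rank or corank one is uniform by transitivity.  In
   rank two the elements parallel to 1 form a subgroup, which is trivial when
   |G| is prime, whatever the order of 2 modulo p.

   If every nonzero vector of L has fewer than dim L zeros, then trop L is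
   uniform.  This holds for the span of the first d powers of a faithful
   character of a cyclic group, because a polynomial of degree < d has fewer
   than d roots.  For G abelian, an invariant L is spanned by the characters it
   contains.  If trop L is U_2 then L contains two distinct characters, and
   their quotient is injective since their difference vanishes only at 1; so G
   is a finite subgroup of the multiplicative group of a field.  For G of prime
   order, Chebotarev's theorem that all minors of the Fourier matrix of order p
   are nonzero shows that every invariant L has a uniform tropicalization.

   To prove Chebotarev's theorem, divide the monomials Y^(j c) by
   prod_b (Y - X^(i b)) over Z[X].  The determinant h(X) of the matrix of
   remainders vanishes at a primitive p-th root of unity as soon as the minor
   does, and then p divides h(1).  But modulo p and at X = 1, a linear relation
   between the remainders gives a polynomial sum_c v_c Y^(j c) over F_p
   divisible by (Y - 1)^k, and k - 1 applications of Y d/dY show that v is in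
   the kernel of the Vandermonde matrix of the distinct residues j c. *)
From HB Require Import structures.
Require Import Defs.
From mathcomp Require Import boolp classical_sets reals.
From mathcomp Require Import all_boot all_order all_algebra all_fingroup.
From mathcomp Require Import all_solvable all_field complex.

Set Implicit Arguments.
Unset Strict Implicit.
Unset Printing Implicit Defensive.

Import GRing.Theory.
Local Open Scope ring_scope.

(** * Matroids and their circuits *)

Section Circuits.
Variable T : finType.
Implicit Types (Bs : {set {set T}}) (B C X : {set T}).

Definition indep Bs X := [exists B in Bs, X \subset B].

Definition antichain Bs :=
  forall B1 B2, B1 \in Bs -> B2 \in Bs -> B1 \subset B2 -> B1 = B2.

Lemma circuits_antichain Bs : antichain (circuits_of Bs).
Proof.
move=> C1 C2; rewrite !inE => /minsetP[d1 _] /minsetP[_ m2] s12.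
exact: m2.
Qed.

Lemma circuits_neq0 Bs C : Bs != finset.set0 -> C \in circuits_of Bs ->
  C != finset.set0.
Proof.
case/set0Pn=> B BBs; rewrite inE => /minsetP[dC _].
apply: contraNneq dC => ->; apply/existsP; exists B.
by rewrite BBs sub0set.
Qed.

Lemma indep_circuits Bs X :
  indep Bs X = ~~ [exists C in circuits_of Bs, C \subset X].
Proof.
apply/idP/idP => [/existsP[B /andP[BBs sXB]] | ].
  apply/negP => /existsP[C /andP[]]; rewrite inE => /minsetP[/negP dC _] sCX.
  by case: dC; apply/existsP; exists B; rewrite BBs (subset_trans sCX).
apply: contraNT => dX.
have [C minC sCX] :=
  @minset_exists T (fun X => ~~ [exists B in Bs, X \subset B]) X dX.
by apply/existsP; exists C; rewrite inE minC.
Qed.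

Lemma antichain_bases_indep Bs B : antichain Bs ->
  (B \in Bs) = maxset (indep Bs) B.
Proof.
move=> acBs; apply/idP/maxsetP => [BBs | [/existsP[B' /andP[B'Bs sBB']] maxB]].
  split; first by apply/existsP; exists B; rewrite BBs subxx.
  move=> X /existsP[B' /andP[B'Bs sXB']] sBX; apply/eqP.
  rewrite eqEsubset sBX andbT.
  by rewrite (acBs _ _ BBs B'Bs (subset_trans sBX sXB')).
rewrite -(maxB B') //; apply/existsP; exists B'; by rewrite B'Bs subxx.
Qed.

(** The circuits determine the independent sets, and the members of an antichain are exactly its
    maximal independent sets. *)
Lemma circuits_of_inj Bs1 Bs2 : antichain Bs1 -> antichain Bs2 ->
  circuits_of Bs1 = circuits_of Bs2 -> Bs1 = Bs2.
Proof.
move=> ac1 ac2 eC; apply/setP=> B.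
rewrite !antichain_bases_indep //; apply: maxset_eq => X.
by rewrite !indep_circuits eC.
Qed.

Lemma imset_circuits (f : T -> T) Bs : bijective f ->
  circuits_of [set f @: (B : {set T}) | B in Bs] =
  [set f @: (C : {set T}) | C in circuits_of Bs].
Proof.
case=> g fK gK.
have fgK : cancel (fun X : {set T} => f @: X) (fun X : {set T} => g @: X).
  by move=> X; rewrite -imset_comp (eq_imset _ fK) imset_id.
have gfK : cancel (fun X : {set T} => g @: X) (fun X : {set T} => f @: X).
  by move=> X; rewrite -imset_comp (eq_imset _ gK) imset_id.
have indepE X : [exists B in [set f @: (B : {set T}) | B in Bs], X \subset B]
    = [exists B in Bs, g @: X \subset B].
  apply/existsP/existsP=> [[B /andP[/imsetP[B' B'Bs ->] sX]] | [B /andP[BBs sX]]].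
    by exists B'; rewrite B'Bs -(fgK B') imsetS.
  exists (f @: B); rewrite imset_f //= -(gfK X); exact: imsetS.
apply/setP=> X; rewrite [in RHS](can2_imset_pre _ fgK gfK) !inE.
apply/minsetP/minsetP=> -[dX mX]; split.
- by move: dX; rewrite indepE.
- move=> Y dY sYX; apply: (can_inj fgK); rewrite gfK.
  apply: mX; first by rewrite indepE fgK.
  by rewrite -(gfK X); apply: imsetS.
- by rewrite indepE.
- move=> Y dY sYX; apply: (can_inj gfK); apply: mX; last exact: imsetS.
  by rewrite -indepE.
Qed.

End Circuits.

Section Matroid.
Variable T : finType.
Implicit Types M : matroid T.

(** Induction on the size of [B1 :\: B2]: exchanging an element of this difference for one of [B2]
    keeps the size of [B1] and shrinks the difference. *)
Lemma basis_card_le M (B1 B2 : {set T}) :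
  B1 \in bases M -> B2 \in bases M -> (#|B1| <= #|B2|)%N.
Proof.
have [n] := ubnP #|B1 :\: B2|; elim: n B1 => // n IHn B1 lt_n B1M B2M.
have [sB12 | /subsetPn[x xB1 xNB2]] := boolP (B1 \subset B2).
  exact: subset_leq_card.
have xD : x \in B1 :\: B2 by rewrite inE xNB2.
have [y] := bases_exchange B1M B2M xD; rewrite inE => /andP[yNB1 yB2] B1'M.
have -> : #|B1| = #|y |: (B1 :\ x)|.
  by rewrite cardsU1 !inE (negPf yNB1) andbF (cardsD1 x B1) xB1.
apply: IHn => //; rewrite -ltnS; apply: leq_trans lt_n; rewrite ltnS.
apply: proper_card; apply/properP; split.
  apply/subsetP=> z; rewrite !inE => /andP[zNB2].
  case/orP=> [/eqP ez | /andP[_ ->]]; last by rewrite zNB2.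
  by rewrite ez yB2 in zNB2.
exists x => //; rewrite !inE eqxx xNB2 /= orbF.
by apply: contraNneq xNB2 => ->.
Qed.

Lemma card_basis M (B : {set T}) : B \in bases M -> #|B| = mrank M.
Proof.
move=> BM; apply/eqP; rewrite eqn_leq; apply/andP; split.
  exact: (bigmax_sup B).
by apply/bigmax_leqP => B' B'M; apply: basis_card_le BM.
Qed.

Lemma eq_mrank M1 M2 : bases M1 = bases M2 -> mrank M1 = mrank M2.
Proof. by rewrite /mrank => ->. Qed.

Definition dual_bases M := [set ~: B | B in bases M].

Lemma dual_bases_neq0 M : dual_bases M != finset.set0.
Proof.
have /set0Pn[B BM] := bases_neq0 M.
by apply/set0Pn; exists (~: B); rewrite imset_f.
Qed.

Lemma dual_bases_antichain M : antichain (dual_bases M).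
Proof.
move=> _ _ /imsetP[B1 B1M ->] /imsetP[B2 B2M ->]; rewrite setCS => s21.
by congr (~: _); apply/esym/eqP; rewrite eqEcard s21 (card_basis B1M) (card_basis B2M) leqnn.
Qed.

Lemma cocircuits_inj M1 M2 : cocircuits M1 = cocircuits M2 ->
  bases M1 = bases M2.
Proof.
move/(circuits_of_inj (@dual_bases_antichain M1) (@dual_bases_antichain M2)).
exact: (imset_inj (@setC_inj T)).
Qed.

Lemma cocircuit_sub_eq M C C' :
  C \in cocircuits M -> C' \in cocircuits M -> C \subset C' -> C = C'.
Proof. exact: circuits_antichain. Qed.

Lemma cocircuit_neq0 M C : C \in cocircuits M -> C != finset.set0.
Proof. by apply: circuits_neq0; apply: dual_bases_neq0. Qed.

End Matroid.

Section BooleanSpan.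
Variable T : finType.
Implicit Types (v : boolmod T) (A : set (boolmod T)) (M : matroid T).

Definition supp v : {set T} := [set x | v x].

Lemma supp_inj : injective supp.
Proof.
by move=> v w /setP e; apply/ffunP=> x; have := e x; rewrite !inE.
Qed.

Lemma supp_indicator (C : {set T}) : supp (indicator C) = C.
Proof. by apply/setP=> x; rewrite inE ffunE. Qed.

Lemma mem_supp_sum (I : Type) (r : seq I) (P : pred I) (F : I -> boolmod T) x :
  (x \in supp (\sum_(i <- r | P i) F i)) =
  has (fun i => P i && (x \in supp (F i))) r.
Proof.
elim: r => [|i r IHr]; first by rewrite big_nil inE ffunE.
by rewrite big_cons; case: ifP => Pi /=; rewrite Pi -IHr // !inE ffunE.
Qed.

(** Boolean addition unites supports, so a vector lies in the span exactly when its support is a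
    union of supports of generators. *)
Lemma bspanP A v : bspan A v <->
  forall x, x \in supp v ->
    exists2 a, A a & x \in supp a /\ supp a \subset supp v.
Proof.
split=> [|vA].
  apply: (@smallest_sub _ _ A
    [set v | forall x, x \in supp v -> exists2 a, A a
       & x \in supp a /\ supp a \subset supp v]%classic); last first.
    by move=> a Aa x xa; exists a.
  split; first split.
  - by apply: mem_set => x; rewrite inE ffunE.
  - move=> u w /set_mem uA /set_mem wA; apply: mem_set => x; rewrite inE ffunE => /orP[ux|wx].
      have [|a Aa [xa sa]] := uA x; first by rewrite inE.
      exists a => //; split => //; apply: subset_trans sa _.
      by apply/subsetP=> y; rewrite !inE ffunE => uy; apply/orP; left.
    have [|a Aa [xa sa]] := wA x; first by rewrite inE.
    exists a => //; split => //; apply: subset_trans sa _.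
    by apply/subsetP=> y; rewrite !inE ffunE => uy; apply/orP; right.
  - move=> a u /set_mem uA; apply: mem_set => x; rewrite inE ffunE => /andP[ta ux].
    have [|b Ab [xb sb]] := uA x; first by rewrite inE.
    exists b => //; split => //; apply: subset_trans sb _.
    by apply/subsetP=> y; rewrite !inE ffunE => uy; apply/andP.
move=> N /= [[[N0 ND] _] sAN].
(* Each point of the support picks a generator through it; off the support the value 0 is a mere
   default. *)
have /choice[F FP] : forall x, exists a, x \in supp v ->
    A a /\ (x \in supp a /\ supp a \subset supp v).
  move=> x; have [/vA[a Aa ?]|] := boolP (x \in supp v); first by exists a.
  by exists 0.
have -> : v = \sum_(x in supp v) F x.
  apply: supp_inj; apply/setP=> x; rewrite mem_supp_sum; apply/idP/hasP.
    by move=> xv; exists x; rewrite ?mem_index_enum ?xv //; case: (FP x xv) => _ [].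
  case=> y _ /andP[yv]; case: (FP y yv) => _ [_ /subsetP]; exact.
apply: set_mem; elim/big_ind: _ => // x xv; apply/mem_set/sAN.
by case: (FP x xv).
Qed.

Lemma trop_linspaceP M v : trop_linspace M v <->
  forall x, x \in supp v ->
    exists2 C, C \in cocircuits M & x \in C /\ C \subset supp v.
Proof.
rewrite /trop_linspace bspanP; split=> vM x /vM[].
  by move=> _ [C CM <-]; rewrite supp_indicator; exists C.
by move=> C CM; exists (indicator C); [exists C | rewrite supp_indicator].
Qed.

Lemma trop_linspace_indicator M C : C \in cocircuits M ->
  trop_linspace M (indicator C).
Proof.
move=> CM; apply/trop_linspaceP => x; rewrite supp_indicator => xC.
by exists C.
Qed.

(** A cocircuit [C] of [M1] contains a cocircuit of [M2], which in turn contains one of [M1]; the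
    latter must be [C] by the antichain property, so all three coincide. *)
Lemma trop_linspace_cocircuits_sub M1 M2 :
  trop_linspace M1 = trop_linspace M2 -> cocircuits M1 \subset cocircuits M2.
Proof.
move=> e; apply/subsetP=> C CM1.
have := trop_linspace_indicator CM1; rewrite e => /trop_linspaceP.
have /set0Pn[x xC] := cocircuit_neq0 CM1; rewrite supp_indicator.
case/(_ x xC)=> C' C'M2 [xC' sC'C].
have := trop_linspace_indicator C'M2; rewrite -e => /trop_linspaceP.
rewrite supp_indicator => /(_ x xC')[C'' C''M1 [_ sC''C']].
have eC := cocircuit_sub_eq C''M1 CM1 (subset_trans sC''C' sC'C).
suff -> : C = C' by [].
by apply/eqP; rewrite eqEsubset sC'C -{1}eC sC''C'.
Qed.

Lemma trop_linspace_eq M1 M2 :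
  trop_linspace M1 = trop_linspace M2 <-> bases M1 = bases M2.
Proof.
split=> [e | e]; last by rewrite /trop_linspace /cocircuits e.
by apply: cocircuits_inj; apply/eqP;
  rewrite eqEsubset !trop_linspace_cocircuits_sub.
Qed.

End BooleanSpan.

(** * Translation of vectors, cocircuits and bases *)

Section Invariance.
Variable gT : finGroupType.
Implicit Types (M : matroid gT) (h : gT).

Lemma mulg_bij h : bijective (mulg h).
Proof. by exists (mulg h^-1)%g; [apply: mulKg | apply: mulKVg]. Qed.

Lemma supp_regact h (v : boolmod gT) :
  supp (regact h v) = mulg h @: supp v.
Proof.
apply/setP=> x; rewrite (can2_imset_pre _ (mulKg h) (mulKVg h)).
by rewrite !inE ffunE.
Qed.

Lemma trop_linspace_regact M h :
  (forall v, trop_linspace M v -> trop_linspace M (regact h v)) <->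
  {in cocircuits M, forall C : {set gT}, mulg h @: C \in cocircuits M}.
Proof.
split=> [hT C CM | hC v vM]; last first.
  apply/trop_linspaceP => x; rewrite supp_regact => /imsetP[y yv ->].
  have [C CM [yC sCv]] := (trop_linspaceP M v).1 vM y yv.
  exists (mulg h @: C); first exact: hC.
  by split; [apply: imset_f | apply: imsetS].
(* The inverse of [h] is a power of [h], so stability under the single element [h] already gives
   stability under its inverse. *)
have hnT n v : trop_linspace M v -> trop_linspace M (regact (h ^+ n)%g v).
  elim: n v => [|n IHn] v Tv.
    suff -> : regact (h ^+ 0)%g v = v by [].
    by apply/ffunP=> x; rewrite ffunE expg0 invg1 mul1g.
  suff -> : regact (h ^+ n.+1)%g v = regact h (regact (h ^+ n)%g v).
    exact: (hT _ (IHn _ Tv)).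
  by apply/ffunP=> x; rewrite !ffunE expgS invMg mulgA.
have h'T v : trop_linspace M v -> trop_linspace M (regact h^-1%g v).
  by rewrite invg_expg; apply: hnT.
have Rk k (B : {set gT}) : supp (regact k (indicator B)) = mulg k @: B.
  by rewrite supp_regact supp_indicator.
have /set0Pn[x xC] := cocircuit_neq0 CM.
have /trop_linspaceP := hT _ (trop_linspace_indicator CM).
rewrite Rk => /(_ (h * x)%g (imset_f _ xC))[C1 C1M [xC1 sC1]].
have /trop_linspaceP := h'T _ (trop_linspace_indicator C1M).
have imK : mulg h^-1%g @: (mulg h @: C) = C.
  by rewrite -imset_comp (eq_imset _ (mulKg h)) imset_id.
have xC1' : x \in mulg h^-1%g @: C1.
  by apply/imsetP; exists (h * x)%g; rewrite ?mulKg.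
rewrite Rk => /(_ x xC1')[C2 C2M [_ sC2]].
have sC1' : mulg h^-1%g @: C1 \subset C by rewrite -imK imsetS.
have eC := cocircuit_sub_eq C2M CM (subset_trans sC2 sC1').
suff -> : mulg h @: C = C1 by [].
have imVK : mulg h @: (mulg h^-1%g @: C1) = C1.
  by rewrite -imset_comp (eq_imset _ (mulKVg h)) imset_id.
by apply/eqP; rewrite eqEsubset sC1 andbT -imVK imsetS // -eC.
Qed.

Lemma imset_subP (S : finType) (f : S -> S) (D : {set S}) : injective f ->
  {in D, forall x, f x \in D} -> [set f x | x in D] = D.
Proof.
move=> injf fD; apply/eqP; rewrite eqEcard card_imset // leqnn andbT.
by apply/subsetP=> _ /imsetP[x xD ->]; apply: fD.
Qed.

(** Translation commutes with complements and with taking circuits, so invariance passes between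
    bases, dual bases and cocircuits; the way back from cocircuits uses that circuits determine an
    antichain. *)
Lemma cocircuits_invariant M h :
  {in cocircuits M, forall C : {set gT}, mulg h @: C \in cocircuits M} <->
  matroid_aut M (mulg h).
Proof.
have injh : injective (fun B : {set gT} => mulg h @: B).
  exact/imset_inj/mulgI.
have imC (B : {set gT}) : mulg h @: (~: B) = ~: (mulg h @: B).
  by apply/setP=> x; rewrite inE !(can2_imset_pre _ (mulKg h) (mulKVg h)) !inE.
have dualE : [set mulg h @: (B : {set gT}) | B in dual_bases M] =
    [set ~: B | B in [set mulg h @: (B : {set gT}) | B in bases M]].
  by rewrite -!imset_comp; apply: eq_imset => B /=.
have ccE : circuits_of [set mulg h @: (B : {set gT}) | B in dual_bases M] =
    [set mulg h @: (C : {set gT}) | C in cocircuits M].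
  exact/imset_circuits/mulg_bij.
split=> [hC | [_ hB] C CM].
  split; first exact: mulg_bij.
  have e : [set mulg h @: (B : {set gT}) | B in dual_bases M] = dual_bases M.
    apply: circuits_of_inj; [|exact: dual_bases_antichain|].
      move=> _ _ /imsetP[B1 B1M ->] /imsetP[B2 B2M ->] s12.
      rewrite (@dual_bases_antichain _ M B1 B2) //.
      apply/subsetP=> x xB1; have := subsetP s12 _ (imset_f (mulg h) xB1).
      by rewrite (mem_imset _ _ (@mulgI _ h)).
    by rewrite ccE; apply: imset_subP.
  move: e; rewrite dualE => /(imset_inj (@setC_inj gT)) e B.
  by rewrite -{1}e (mem_imset _ _ injh).
have e : [set mulg h @: (B : {set gT}) | B in bases M] = bases M.
  by apply: imset_subP => // B BM; rewrite hB.
rewrite e in dualE.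
have : mulg h @: C \in [set mulg h @: (C : {set gT}) | C in cocircuits M].
  exact: imset_f.
by rewrite -ccE dualE.
Qed.

Lemma trop_rep_linspaceP M :
  trop_rep (mrank M) (trop_linspace M) <->
  forall h, matroid_aut M (fun g => (h * g)%g).
Proof.
split=> [[_ hT] h | hM].
  by apply/cocircuits_invariant/trop_linspace_regact => v; apply: hT.
split; first by exists M.
by move=> h; apply/trop_linspace_regact/cocircuits_invariant/hM.
Qed.

Lemma trop_repP d (T : set (boolmod gT)) :
  trop_rep d T <-> exists M : matroid gT,
    [/\ mrank M = d, T = trop_linspace M
      & forall h, matroid_aut M (fun g => (h * g)%g)].
Proof.
split=> [Tr | [M [<- -> hM]]]; last exact/trop_rep_linspaceP.
have [[M rM eT] _] := Tr; exists M; split=> //.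
by apply/trop_rep_linspaceP; rewrite rM -eT.
Qed.

End Invariance.

(** * Invariant matroids *)

Lemma subset_of_card (T : finType) (A : {set T}) k : (k <= #|A|)%N ->
  exists2 B : {set T}, B \subset A & #|B| = k.
Proof.
move=> lekA; have : (0 < #|[set B : {set T} | B \subset A & #|B| == k]|)%N.
  by rewrite cards_draws bin_gt0.
by case/card_gt0P=> B; rewrite inE => /andP[sBA /eqP cB]; exists B.
Qed.

Section Uniform.
Variable T : finType.
Implicit Type M : matroid T.

Lemma mrank_uniform d : mrank (uniform_matroid d T) = minn d #|T|.
Proof.
have /set0Pn[B BM] := bases_neq0 (uniform_matroid d T).
by rewrite -(card_basis BM); move: BM; rewrite inE => /eqP.
Qed.

Lemma bases_uniform M d : mrank M = d ->
    (forall B : {set T}, #|B| = d -> B \in bases M) ->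
  bases M = bases (uniform_matroid d T).
Proof.
move=> rM dM; have /set0Pn[B0 B0M] := bases_neq0 M.
have led : (d <= #|T|)%N by rewrite -rM -(card_basis B0M) max_card.
apply/setP=> B; rewrite !inE (minn_idPl led).
by apply/idP/eqP=> [/card_basis-> // | /dM].
Qed.

Lemma cocircuits_uniform d : (d <= #|T|)%N ->
  cocircuits (uniform_matroid d T) = [set C : {set T} | #|C| == (#|T| - d).+1].
Proof.
move=> led.
(* Dual bases have [#|T| - d] elements, so the sets dependent in the dual are those with more
   elements than that. *)
have indepE (X : {set T}) : ~~ [exists B in dual_bases (uniform_matroid d T), X \subset B]
    = (#|T| - d < #|X|)%N.
  rewrite ltnNge; congr (~~ _); apply/existsP/idP => [[B /andP[]] | leX].
    case/imsetP=> B'; rewrite inE (minn_idPl led) => /eqP cB' -> sX.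
    by apply: leq_trans (subset_leq_card sX) _; rewrite cardsCs setCK cB'.
  have [|B sB cB] := @subset_of_card _ (~: X) d.
    by rewrite -(leq_add2l #|X|) cardsC addnC -leq_subRL.
  exists (~: B); rewrite imset_f ?inE ?cB ?(minn_idPl led) //=.
  by rewrite -setCS setCK.
apply/setP=> C; rewrite !inE; apply/minsetP/eqP => [[dC mC] | cC].
  rewrite indepE in dC; have [B sB cB] := subset_of_card dC.
  by rewrite -(mC B) // indepE cB.
split=> [|X]; first by rewrite indepE cC.
rewrite indepE => ltX sXC; apply/eqP; rewrite eqEcard sXC cC; exact: ltX.
Qed.

End Uniform.

Section InvariantMatroids.
Variable gT : finGroupType.
Implicit Types (M : matroid gT) (h x y z : gT).

Lemma trop_rep_uniform d : (d <= #|gT|)%N ->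
  trop_rep d (trop_linspace (uniform_matroid d gT)).
Proof.
move=> led; apply/trop_repP; exists (uniform_matroid d gT); split=> //.
  by rewrite mrank_uniform (minn_idPl led).
move=> h; split; first exact: mulg_bij.
by move=> B; rewrite !inE card_imset //; apply: mulgI.
Qed.

Lemma trop_rep_unique d : (d <= #|gT|)%N ->
    (forall M, mrank M = d -> (forall h, matroid_aut M (mulg h)) ->
      forall B : {set gT}, #|B| = d -> B \in bases M) ->
  forall T : set (boolmod gT),
    trop_rep d T <-> T = trop_linspace (uniform_matroid d gT).
Proof.
move=> led unifM T; split=> [/trop_repP[M [rM -> hM]] | ->].
  by apply/trop_linspace_eq/bases_uniform => //; apply: unifM.
exact: trop_rep_uniform.
Qed.

Lemma trop_rep1 (T : set (boolmod gT)) :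
  trop_rep 1 T <-> T = trop_linspace (uniform_matroid 1 gT).
Proof.
apply: trop_rep_unique; first by rewrite -cardsT cardG_gt0.
move=> M rM hM B /eqP/cards1P[b ->].
have /set0Pn[A AM] := bases_neq0 M; have := card_basis AM.
rewrite rM => /eqP/cards1P[a eA]; rewrite eA in AM.
(* Translation by [b * a^-1] carries the known basis [[set a]] to [[set b]]. *)
by have := (hM (b * a^-1)%g).2 [set a]; rewrite imset_set1 mulgKV AM.
Qed.

Lemma trop_rep_codim1 (T : set (boolmod gT)) :
  trop_rep #|gT|.-1 T <-> T = trop_linspace (uniform_matroid #|gT|.-1 gT).
Proof.
have n_gt0 : (0 < #|gT|)%N by rewrite -cardsT cardG_gt0.
have cC (B : {set gT}) : #|B| = #|gT|.-1 -> exists b, B = [set~ b].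
  move=> cB; have /eqP/cards1P[b eB] : #|~: B| = 1%N.
    by rewrite cardsCs setCK cB -subn1 subKn.
  by exists b; rewrite -eB setCK.
apply: trop_rep_unique; first exact: leq_pred.
move=> M rM hM B /cC[b ->].
have /set0Pn[A AM] := bases_neq0 M; have := card_basis AM.
rewrite rM => /cC[a eA]; rewrite eA in AM.
suff -> : [set~ b] = mulg (b * a^-1)%g @: [set~ a] by rewrite (hM _).2.
apply/setP=> x.
rewrite (can2_imset_pre _ (mulKg _) (mulKVg _)) !inE.
by rewrite -[in RHS](inj_eq (mulgI (b * a^-1)%g)) mulKVg mulgKV.
Qed.

(** * Parallel elements in an invariant matroid of rank two *)

Section RankTwo.
Variable M : matroid gT.
Hypothesis rM : mrank M = 2.
Hypothesis hM : forall h, matroid_aut M (mulg h).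

Lemma pair_basis_mul h x y :
  ([set h * x; h * y]%g \in bases M) = ([set x; y] \in bases M).
Proof. by rewrite -[in RHS](hM h).2 imsetU1 imset_set1. Qed.

Lemma pair_basis_neq x y : [set x; y] \in bases M -> x != y.
Proof. by move/card_basis; rewrite rM cards2; case: eqP. Qed.

Lemma basis_through y : exists w, [set y; w] \in bases M.
Proof.
have /set0Pn[B BM] := bases_neq0 M; have := card_basis BM.
rewrite rM => /eqP/cards2P[a [b [_ eB]]]; rewrite eB in BM.
exists (y * a^-1 * b)%g.
by rewrite -[X in [set X; _]](mulgKV a) pair_basis_mul.
Qed.

(** If [[set x; z]] were a basis, take a basis [[set y; w]]. Exchanging [w] against [[set x; z]]
    would make [[set x; y]] or [[set y; z]] a basis. *)
Lemma parallel_trans x y z : [set x; y] \notin bases M ->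
  [set y; z] \notin bases M -> [set x; z] \notin bases M.
Proof.
move=> Nxy Nyz; apply/negP => xzM; have [w ywM] := basis_through y.
have neq_yw := pair_basis_neq ywM.
have [wx | neq_wx] := eqVneq w x; first by rewrite setUC -wx ywM in Nxy.
have [wz | neq_wz] := eqVneq w z; first by rewrite -wz ywM in Nyz.
have wD : w \in [set y; w] :\: [set x; z].
  by rewrite !inE eqxx orbT negb_or neq_wx neq_wz.
have [u] := bases_exchange ywM xzM wD.
have -> : [set y; w] :\ w = [set y].
  apply/setP=> v; rewrite !inE andb_orr andNb orbF.
  by have [->|_] := eqVneq v y; rewrite ?neq_yw ?andbF.
rewrite !inE => /andP[_ /orP[]/eqP->]; first exact/negP.
by rewrite setUC; apply/negP.
Qed.

Lemma rank2_prime_uniform : prime #|gT| ->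
  forall B : {set gT}, #|B| = 2 -> B \in bases M.
Proof.
move=> p_pr B /eqP/cards2P[x [y [neq_xy ->]]].
pose H := [set h | [set 1%g; h] \notin bases M].
have gH : group_set H.
  apply/group_setP; split.
    by rewrite inE; apply/negP => /pair_basis_neq; rewrite eqxx.
  (* 1 is parallel to [a], and [a] is parallel to [a * b] by translating the pair of 1 and [b]. *)
  move=> a b; rewrite !inE => Na Nb; apply: (parallel_trans Na).
  by rewrite -{1}(mulg1 a) pair_basis_mul.
have pairE a b : ([set a; b] \in bases M) = ((a^-1 * b)%g \notin H).
  by rewrite inE negbK -(pair_basis_mul a^-1) mulVg.
rewrite pairE.
have /= := cardSg (subsetT (group gH)); rewrite cardsT.
case/primeP: p_pr => _ dvd_p /dvd_p /orP[/eqP H1 | /eqP HT].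
  have /trivgP : (group gH :=: 1)%g by apply/eqP; rewrite trivg_card1 /= H1.
  move/subsetP=> sH1; apply/negP => /sH1/set1P/eqP.
  by rewrite -eq_mulVg1 (negPf neq_xy).
(* [H] is not the whole group, because 1 lies in some basis. *)
have [w] := basis_through 1%g; rewrite pairE.
suff -> : H = [set: gT] by rewrite inE.
by apply/eqP; rewrite eqEcard subsetT cardsT HT /=.
Qed.

End RankTwo.

Lemma trop_rep2_prime : prime #|gT| -> forall T : set (boolmod gT),
  trop_rep 2 T <-> T = trop_linspace (uniform_matroid 2 gT).
Proof.
move=> p_pr; apply: trop_rep_unique; first exact: prime_gt1.
by move=> M rM hM; apply: rank2_prime_uniform.
Qed.

End InvariantMatroids.

(** * Realizability of uniform matroids *)

Section Realizability.
Variables (gT : finGroupType) (R : realType).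
Local Notation C := (R[i]).
Local Notation CG := (complexGA gT R).
Implicit Types (L : {vspace CG}) (w : CG) (Z : {set gT}).

Lemma supp_support_vec w : supp (support_vec w) = [set g | w g != 0].
Proof. by apply/setP=> g; rewrite !inE ffunE. Qed.

Definition zeros w : {set gT} := [set g | w g == 0].

Lemma card_supp_zeros w : (#|supp (support_vec w)| = #|gT| - #|zeros w|)%N.
Proof.
rewrite cardsCs; congr (_ - #|pred_of_set _|)%N.
by apply/setP=> g; rewrite supp_support_vec !inE negbK.
Qed.

Definition restrict Z w : 'rV[C]_#|Z| := \row_i w (enum_val i).

Fact restrict_linear Z : linear (restrict Z).
Proof. by move=> a u v; apply/rowP=> i; rewrite !mxE !ffunE. Qed.

HB.instance Definition _ Z := GRing.isLinear.Build C CG 'rV[C]_#|Z| *:%R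
  (restrict Z) (restrict_linear Z).

(** Rank-nullity for the restriction of [L] to the coordinates in [Z], whose rank is at most
    [#|Z|]. *)
Lemma exists_vanishing L Z : (#|Z| < \dim L)%N ->
  exists2 w, w \in L & w != 0 /\ Z \subset zeros w.
Proof.
move=> ltZ; pose f := linfun (restrict Z).
have : (0 < \dim (L :&: lker f))%N.
  rewrite -(ltn_add2r (\dim (f @: L))) limg_ker_dim add0n.
  apply: leq_ltn_trans (dimvS (subvf _)) _; by rewrite dimvf /dim /= mul1n.
rewrite lt0n dimv_eq0 => nz.
exists (vpick (L :&: lker f)%VS).
  by have := memv_pick (L :&: lker f); rewrite memv_cap => /andP[].
split; first by rewrite vpick0.
have := memv_pick (L :&: lker f); rewrite memv_cap => /andP[_].
rewrite memv_ker lfunE /= => /eqP/rowP w0.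
apply/subsetP=> z zZ; rewrite inE; have := w0 (enum_rank_in zZ z).
by rewrite !mxE enum_rankK_in // => ->.
Qed.

(** Cocircuits of the uniform matroid are the sets of size [#|gT| - d + 1]. Every nonzero support is
    at least that large, hence a union of cocircuits; conversely a nonzero vector of [L] vanishing
    off a cocircuit has it as its exact support. *)
Lemma trop_uniform L d : (d <= #|gT|)%N -> (d <= \dim L)%N ->
    (forall w, w \in L -> w != 0 -> (#|zeros w| < d)%N) ->
  trop L = trop_linspace (uniform_matroid d gT).
Proof.
move=> led dimL zeroL.
have suppL w : w \in L -> w != 0 -> (#|gT| - d < #|supp (support_vec w)|)%N.
  move=> wL nzw; have ltz := zeroL w wL nzw.
  by rewrite card_supp_zeros ltn_sub2l // (leq_trans ltz).
apply/seteqP; split=> v /=.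
  move/bspanP=> vL; apply/trop_linspaceP => x /vL[_ [w wL <-] [xw sw]].
  have nzw : w != 0.
    by apply: contraTneq xw => ->; rewrite supp_support_vec inE ffunE eqxx.
  have := suppL w wL nzw; rewrite (cardsD1 x) xw ltnS => le_n.
  have [B sB cB] := subset_of_card le_n.
  exists (x |: B).
    rewrite cocircuits_uniform // inE cardsU1 cB.
    by case: (boolP (x \in B)) => // /(subsetP sB); rewrite !inE eqxx.
  rewrite setU11; split=> //; apply: subset_trans sw.
  by rewrite subUset sub1set xw (subset_trans sB) // subD1set.
move/trop_linspaceP=> vM; apply/bspanP => x /vM[D].
rewrite cocircuits_uniform // inE => /eqP cD [xD sD].
(* The complement of [D] has [d - 1] elements; [d] is positive because [D] fits into the ground
   set. *)
have [|w wL [nzw sz]] := @exists_vanishing L (~: D).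
  apply: leq_trans dimL; rewrite cardsCs setCK cD subnS subKn //.
  rewrite prednK // lt0n; apply: contraTneq (max_card (mem D)) => d0.
  by rewrite cD d0 subn0 -ltnNge.
have eD : supp (support_vec w) = D.
  apply/eqP; rewrite eqEcard cD suppL // andbT.
  rewrite -setCS; apply: subset_trans sz _.
  by apply/subsetP=> g; rewrite supp_support_vec !inE negbK.
by exists (support_vec w); [exists w | rewrite eD].
Qed.

Section Converse.
Variables (L : {vspace CG}) (d : nat).
Hypotheses (led : (d <= #|gT|)%N)
           (tropL : trop L = trop_linspace (uniform_matroid d gT)).

Lemma trop_uniform_zeros w : w \in L -> w != 0 -> (#|zeros w| < d)%N.
Proof.
move=> wL nzw.
have [x xw] : exists x, x \in supp (support_vec w).
  apply/set0Pn; apply: contraNneq nzw => /setP w0; apply/eqP/ffunP=> x.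
  have := w0 x; rewrite supp_support_vec !inE ffunE => /negbT.
  by rewrite negbK => /eqP.
have : trop L (support_vec w).
  by apply/bspanP => y yw; exists (support_vec w); [exists w | ].
rewrite tropL => /trop_linspaceP/(_ x xw)[D].
rewrite cocircuits_uniform // inE => /eqP cD [_ /subset_leq_card].
rewrite cD card_supp_zeros ltn_subRL addnC -ltn_subRL subKn //.
Qed.

(** The indicator of the cocircuit [D] is a union of supports from [L]; by the bound on zeros, a
    nonempty support inside [D] fills it. *)
Lemma trop_uniform_support (D : {set gT}) : #|D| = (#|gT| - d).+1 ->
  exists2 w, w \in L & zeros w = ~: D.
Proof.
move=> cD; have DM : D \in cocircuits (uniform_matroid d gT).
  by rewrite cocircuits_uniform // inE cD.
have := trop_linspace_indicator DM; rewrite -tropL => /bspanP.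
have /set0Pn[x xD] := cocircuit_neq0 DM.
rewrite supp_indicator => /(_ x xD)[_ [w wL <-] [xw sw]].
exists w => //; suff <- : supp (support_vec w) = D.
  by apply/setP=> g; rewrite supp_support_vec !inE negbK.
have nzw : w != 0.
  by apply: contraTneq xw => ->; rewrite supp_support_vec inE ffunE eqxx.
apply/eqP; rewrite eqEcard sw cD card_supp_zeros /=.
by rewrite ltn_sub2l ?trop_uniform_zeros // (leq_trans (trop_uniform_zeros wL nzw)).
Qed.

End Converse.

Lemma realizable_uniform1 :
  realizable R (trop_linspace (uniform_matroid 1 gT)).
Proof.
pose v : CG := [ffun=> 1].
have nzv : v != 0.
  by apply/eqP => /ffunP/(_ 1%g)/eqP; rewrite !ffunE oner_eq0.
exists <[v]>%VS; split.
  move=> h w /vlineP[a ->]; apply/vlineP; exists a.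
  by apply/ffunP=> x; rewrite !ffunE.
rewrite (@trop_uniform _ 1) //; first by rewrite -cardsT cardG_gt0.
  by rewrite dim_vline nzv.
move=> w /vlineP[a ->]; rewrite scaler_eq0 negb_or => /andP[nza _].
rewrite ltnS leqn0 cards_eq0 -subset0; apply/subsetP=> x.
by rewrite !inE !ffunE /= [a *: _]mulr1 (negPf nza).
Qed.

Definition coordsum w : C^o := \sum_g w g.

Fact coordsum_linear : linear coordsum.
Proof.
move=> a u v; rewrite /coordsum scaler_sumr -big_split /=.
by apply: eq_bigr => g _; rewrite !ffunE.
Qed.

HB.instance Definition _ := GRing.isLinear.Build C CG C^o *:%R
  coordsum coordsum_linear.

(** The hyperplane of vectors with coordinate sum 0 works: a nonzero such vector has at least two
    nonzero coordinates. *)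
Lemma realizable_uniform_codim1 :
  realizable R (trop_linspace (uniform_matroid #|gT|.-1 gT)).
Proof.
pose f := linfun coordsum.
have mem_ker w : (w \in lker f) = (\sum_g w g == 0) by rewrite memv_ker lfunE.
exists (lker f); split=> [h w |].
  rewrite !mem_ker => w0; rewrite (reindex_inj (mulgI h)) /=.
  by under eq_bigr do rewrite ffunE mulKg.
rewrite (@trop_uniform _ #|gT|.-1) ?leq_pred //.
  rewrite -subn1 leq_subLR.
  have := limg_ker_dim f fullv; rewrite capfv dimvf /dim /= muln1 => <-.
  rewrite addnC leq_add2r; apply: leq_trans (dimvS (subvf _)) _.
  by rewrite dimvf.
move=> w; rewrite mem_ker => /eqP w0 nzw.
have n_gt0 : (0 < #|gT|)%N by rewrite -cardsT cardG_gt0.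
have [x nzx] : exists x, w x != 0.
  apply/existsP; rewrite -negb_forall; apply: contra nzw => /forallP wx.
  by apply/eqP/ffunP=> x; rewrite ffunE; apply/eqP.
have [y neq_yx nzy] : exists2 y, y != x & w y != 0.
  apply/exists_inP; rewrite -negb_forall_in; apply: contra nzx => /forall_inP wy.
  by rewrite -w0 (bigD1 x) //= big1 ?addr0 // => y /wy/eqP.
have szw : zeros w \subset ~: [set x; y].
  apply/subsetP=> g; rewrite !inE => /eqP wg0.
  apply/norP; split; [apply: contraNneq nzx | apply: contraNneq nzy] => <-;
  exact/eqP.
have c2 : #|[set x; y]| = 2 by rewrite cards2 eq_sym neq_yx.
apply: leq_ltn_trans (subset_leq_card szw) _.
have := max_card (mem [set x; y]); rewrite cardsCs setCK c2.
by case: #|gT| => [|[|n]] //; rewrite !subSS subn0.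
Qed.

End Realizability.

(** * Minors of the Fourier matrix of prime order *)

Section Chebotarev.
Variable p : nat.
Hypothesis p_pr : prime p.

Lemma root_geom (F : fieldType) (x : F) : p%:R != 0 :> F ->
  (\sum_(i < p) x ^+ i == 0) = p.-primitive_root x.
Proof.
move=> nzp; have p_gt0 := prime_gt0 p_pr.
have eX : x ^+ p - 1 = (x - 1) * \sum_(i < p) x ^+ i by rewrite subrX1.
apply/idP/idP=> [/eqP g0 | prim_x].
  have xp1 : x ^+ p = 1 by apply/eqP; rewrite -subr_eq0 eX g0 mulr0.
  have [m prim_x] := prim_order_exists p_gt0 xp1.
  case/primeP: p_pr => _ dvd_p /dvd_p /orP[] /eqP em; last by rewrite -em.
  have x1 : x = 1 by rewrite -[x]expr1 -em (prim_expr_order prim_x).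
  move: g0; rewrite x1.
  under eq_bigr do rewrite expr1n.
  by rewrite sumr_const card_ord => /eqP; rewrite (negPf nzp).
have /eqP := eX; rewrite (prim_expr_order prim_x) subrr eq_sym mulf_eq0.
case/orP=> //; rewrite subr_eq0 => /eqP x1.
have := prim_order_dvd prim_x 1; rewrite expr1 x1 eqxx dvdn1 => /eqP p1.
by move: p_pr; rewrite p1.
Qed.

Lemma horner_geom (F : comNzRingType) (x : F) :
  (\sum_(i < p) 'X^i).[x] = \sum_(i < p) x ^+ i.
Proof. by rewrite horner_sum; apply: eq_bigr => i _; rewrite hornerXn. Qed.

Lemma map_geom (A B : nzRingType) (f : {rmorphism A -> B}) :
  map_poly f (\sum_(i < p) 'X^i) = \sum_(i < p) 'X^i.
Proof. by rewrite rmorph_sum; apply: eq_bigr => i _ /=; rewrite map_polyXn. Qed.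

Lemma geom_poly_def (A : nzRingType) :
  \sum_(i < p) 'X^i = \poly_(i < p) 1 :> {poly A}.
Proof. by rewrite poly_def; apply: eq_bigr => i _; rewrite scale1r. Qed.

Lemma monic_geom (A : nzRingType) : \sum_(i < p) 'X^i \is @monic A.
Proof.
have := prime_gt0 p_pr; rewrite geom_poly_def; case: p => // n _.
by rewrite monicE lead_coef_poly ?oner_eq0.
Qed.

Lemma size_geom (A : nzRingType) : size (\sum_(i < p) 'X^i : {poly A}) = p.
Proof.
have := prime_gt0 p_pr; rewrite geom_poly_def; case: p => // n _.
by rewrite size_poly_eq ?oner_eq0.
Qed.

(** The geometric sum is the minimal polynomial over the rationals of a primitive [p]-th root of
    unity. As it is monic, the division can be carried out over the integers. *)
Lemma geom_dvd_int (F : numFieldType) (z : F) (h : {poly int}) :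
  p.-primitive_root z -> root (map_poly intr h) z ->
  exists q, h = q * \sum_(i < p) 'X^i.
Proof.
move=> prim_z hz0.
have nzp (K : numFieldType) : p%:R != 0 :> K.
  by rewrite Num.Theory.pnatr_eq0 -lt0n prime_gt0.
pose hQ : {poly rat} := map_poly intr h.
pose g : {poly rat} := \sum_(i < p) 'X^i.
have mapQ (K : numFieldType) : map_poly ratr hQ = map_poly intr h :> {poly K}.
  by rewrite -map_poly_comp; apply: eq_map_poly => a /=; rewrite ratr_int.
(* Minimal polynomials are taken in [algC], so the common root is moved there: a Bezout identity
   over the rationals would fail at [z], hence the two polynomials share a root in [algC]. *)
have [y prim_y hy0] :
    exists2 y : algC, p.-primitive_root y & root (map_poly ratr hQ) y.
  have : ~~ coprimep g hQ.
    apply/negP => /Bezout_eq1_coprimepP[[u v] /= /(congr1 (map_poly (ratr : rat -> F)))].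
    rewrite rmorphD !rmorphM rmorph1 /= mapQ map_geom => /(congr1 (fun f => f.[z])).
    rewrite hornerD !hornerM (rootP hz0) horner_geom hornerC => /eqP.
    have /eqP -> : \sum_(i < p) z ^+ i == 0 by rewrite root_geom ?nzp.
    by rewrite !mulr0 addr0 eq_sym oner_eq0.
  rewrite coprimep_def -(size_map_poly (ratr : {rmorphism rat -> algC})).
  case/closed_rootP=> y; rewrite gcdp_map root_gcd map_geom => /andP[gy hy].
  by exists y => //; rewrite -root_geom ?nzp // -horner_geom.
pose r := Pdiv.CommonRing.rmodp h (\sum_(i < p) 'X^i).
have eh := Pdiv.RingMonic.rdivp_eq (monic_geom _) h.
suff r0 : r = 0 by rewrite -/r r0 addr0 in eh; exists (Pdiv.CommonRing.rdivp h (\sum_(i < p) 'X^i)).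
have szr : (size r < p)%N.
  rewrite -[X in (_ < X)%N](size_geom int) Pdiv.CommonRing.ltn_rmodpN0 //.
  by rewrite monic_neq0 ?monic_geom.
have ry : root (map_poly ratr (map_poly intr r : {poly rat})) y.
  move: hy0; rewrite /hQ {1}eh rmorphD rmorphM /= map_geom.
  rewrite rmorphD rmorphM /= map_geom /root hornerD hornerM horner_geom.
  have /eqP -> : \sum_(i < p) y ^+ i == 0 by rewrite root_geom ?nzp.
  by rewrite mulr0 add0r.
have [m [em mon_m div_m]] := minCpolyP y.
apply/eqP; apply: contraLR szr => nzr; rewrite -leqNgt.
have nzrQ : map_poly intr r != 0 :> {poly rat}.
  by rewrite map_poly_eq0_id0 // intr_eq0 lead_coef_eq0.
rewrite div_m in ry; have := dvdp_leq nzrQ ry.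
have -> : size m = p.
  rewrite -(size_map_poly (ratr : {rmorphism rat -> algC})) -em.
  rewrite (minCpoly_cyclotomic prim_y) size_cyclotomic totient_prime //.
  by rewrite prednK // prime_gt0.
by rewrite size_map_inj_poly //; apply: intr_inj.
Qed.


Section Minor.
Variables (k : nat) (i j : 'I_k -> 'I_p).
Hypotheses (inj_i : injective i) (inj_j : injective j).
Local Notation A := {poly int}.

(** The powers of ['X] stand for the evaluation points. Keeping ['X] indeterminate allows two
    specialisations: to a root of unity, and to 1 modulo [p]. *)
Definition node_poly : {poly A} := \prod_(b < k) ('X - ('X^(i b))%:P).
Definition node_quo (c : 'I_k) : {poly A} :=
  Pdiv.CommonRing.rdivp 'X^(j c) node_poly.
Definition node_rem (c : 'I_k) : {poly A} :=
  Pdiv.CommonRing.rmodp 'X^(j c) node_poly.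

Lemma size_node_rem c : (size (node_rem c) <= k)%N.
Proof.
have szw : size node_poly = k.+1.
  by rewrite /node_poly -big_enum size_prod_XsubC size_enum_ord.
by rewrite -ltnS -szw Pdiv.CommonRing.ltn_rmodpN0 // -size_poly_gt0 szw.
Qed.

Lemma map_node_rem (K : comNzRingType) (f : {rmorphism A -> K}) c :
  'X^(j c) = map_poly f (node_quo c) * \prod_(b < k) ('X - (f 'X ^+ i b)%:P)
             + map_poly f (node_rem c).
Proof.
have monw : node_poly \is monic by apply: monic_prod_XsubC.
have := congr1 (map_poly f) (Pdiv.RingMonic.rdivp_eq monw 'X^(j c)).
rewrite map_polyXn rmorphD rmorphM /= => ->.
congr (_ * _ + _); rewrite rmorph_prod; apply: eq_bigr => b _ /=.
by rewrite rmorphB /= map_polyX map_polyC /= rmorphXn.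
Qed.

(* Its determinant is, up to sign, the quotient of the generic Fourier minor
   with entries X^(i b * j c) by the Vandermonde determinant of the X^(i b). *)
Definition rem_mx : 'M[A]_k := \matrix_(c, m) (node_rem c)`_m.

(** The rows list all coefficients of the remainders, which have size at most [k], so the left
    kernel consists of the linear relations between remainders. *)
Lemma rem_mx_ker (K : comNzRingType) (f : {rmorphism A -> K}) (v : 'rV[K]_k) :
  v *m map_mx f rem_mx = 0 <->
  \sum_c v 0 c *: map_poly f (node_rem c) = 0.
Proof.
split=> [v0 | v0].
  apply/polyP=> m; rewrite coef_sum coef0.
  under eq_bigr do rewrite coefZ coef_map.
  have [ltmk | lekm] := ltnP m k.
    have /rowP/(_ (Ordinal ltmk)) := v0; rewrite !mxE => e.
    by rewrite -[RHS]e; apply: eq_bigr => c _; rewrite !mxE.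
  apply: big1 => c _; rewrite nth_default ?raddf0 ?mulr0 //.
  exact: leq_trans (size_node_rem c) lekm.
apply/rowP=> m; rewrite !mxE; have /polyP/(_ m) := v0.
rewrite coef_sum coef0 => e; rewrite -[RHS]e.
by apply: eq_bigr => c _; rewrite !mxE coefZ coef_map.
Qed.

Local Notation theta := (fun g => 'X * g^`()).

(** Each application of [theta] lowers the order of vanishing at 1 by at most one. *)
Lemma iter_theta_root (K : comNzRingType) n m (g s : {poly K}) :
  (m < n)%N -> g = s * ('X - 1%:P) ^+ n -> (iter m theta g).[1] = 0.
Proof.
elim: n m g s => // n IHn [|m] g s lt_mn eg.
  by rewrite /= eg hornerM horner_exp hornerXsubC subrr expr0n mulr0.
rewrite iterSr; apply: (IHn m _ ('X * (s^`() * ('X - 1%:P) + s *+ n.+1))) => //.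
rewrite eg derivM deriv_exp derivXsubC mul1r exprS -mulrA; congr ('X * _).
by rewrite [RHS]mulrDl mulrA mulrnAr mulrnAl.
Qed.

Lemma iter_theta_sum (K : comNzRingType) m (v : 'I_k -> K) :
  iter m theta (\sum_c v c *: 'X^(j c)) =
  \sum_c (v c * (j c)%:R ^+ m) *: 'X^(j c).
Proof.
elim: m => [|m IHm]; first by apply: eq_bigr => c _; rewrite mulr1.
rewrite iterS IHm raddf_sum mulr_sumr; apply: eq_bigr => c _.
rewrite /= derivZ derivXn -scalerAr; case: (nat_of_ord (j c)) => [|n].
  by rewrite mulr0n mulr0 scaler0 exprS mul0r mulr0 scale0r.
by rewrite /= mulrnAr -exprS (exprSr n.+1%:R) mulrA -scalerA scaler_nat.
Qed.

Lemma det_rem_mx_Fp (f : {rmorphism A -> 'F_p}) : f 'X = 1 ->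
  f (\det rem_mx) != 0.
Proof.
move=> fX1; rewrite -det_map_mx; apply/negP => /det0P[v nzv].
move/rem_mx_ker=> v0; case/negP: nzv.
pose s := \sum_c v 0 c *: map_poly f (node_quo c).
(* All nodes specialise to 1, so the product over the nodes becomes a [k]-th power. *)
have eg : \sum_c v 0 c *: 'X^(j c) = s * ('X - 1%:P) ^+ k.
  rewrite -[RHS]addr0 -[X in _ + X]v0 /s mulr_suml -big_split /=.
  apply: eq_bigr => c _.
  rewrite (map_node_rem f c) scalerDr -scalerAl fX1.
  under [in LHS]eq_bigr do rewrite expr1n.
  by rewrite prodr_const card_ord.
pose a : 'rV['F_p]_k := \row_c (j c)%:R.
have vV0 : v *m (Vandermonde k a)^T = 0.
  apply/rowP=> m; have := iter_theta_root (ltn_ord m) eg.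
  rewrite iter_theta_sum horner_sum !mxE => e; rewrite -[RHS]e; apply: eq_bigr => c _.
  by rewrite !mxE hornerZ hornerXn expr1n mulr1.
have unitV : (Vandermonde k a)^T \in unitmx.
  rewrite unitmx_tr unitmxE unitfE det_Vandermonde.
  apply/prodf_neq0 => b _; apply/prodf_neq0 => c lt_bc.
  rewrite !mxE subr_eq0; apply/negP => /eqP/(congr1 (@nat_of_ord _)).
  rewrite !val_Fp_nat // !modn_small // => /val_inj/inj_j ebc.
  by rewrite ebc ltnn in lt_bc.
by rewrite -(mulmxK unitV v) vV0 mul0mx.
Qed.

(** Nonvanishing of the minor is phrased as triviality of its kernel, the form that bounds the zeros
    of a combination of characters. *)
Lemma chebotarev (F : numFieldType) (z : F) (a : 'I_k -> F) :
    p.-primitive_root z ->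
    (forall b, \sum_c a c * z ^+ (i b * j c) = 0) ->
  forall c, a c = 0.
Proof.
move=> prim_z a0.
pose f : {rmorphism A -> F} := horner_morph (fun n : int => mulrC z n%:~R).
have fE h : f h = (map_poly intr h).[z] by [].
(* Otherwise the geometric sum divides the determinant; at 1 modulo [p] that sum is [p], which is 0,
   against [det_rem_mx_Fp]. *)
have nzdet : \det (map_mx f rem_mx) != 0.
  rewrite det_map_mx; apply/eqP; rewrite fE => /rootP/(geom_dvd_int prim_z)[q eh].
  pose g : {rmorphism A -> 'F_p} :=
    horner_morph (fun n : int => mulrC (1 : 'F_p) n%:~R).
  have gX : g 'X = 1 by rewrite /g /= horner_morphX.
  have := det_rem_mx_Fp gX; rewrite eh rmorphM rmorph_sum /=.
  under eq_bigr do rewrite rmorphXn /= gX expr1n.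
  by rewrite sumr_const card_ord -[_ *+ p]Fp_nat_mod // modnn mulr0 eqxx.
(* This combination of remainders has size at most [k] and vanishes at the [k] distinct points
   [z ^+ i b]. *)
have v0 : \sum_c a c *: map_poly f (node_rem c) = 0.
  apply: (@roots_geq_poly_eq0 _ _ [seq z ^+ i b | b <- enum 'I_k]).
  - apply/allP=> _ /mapP[b _ ->]; rewrite /root horner_sum -[X in _ == X](a0 b).
    apply/eqP/eq_bigr=> c _; rewrite hornerZ; congr (_ * _).
    have := congr1 (fun g => g.[z ^+ i b]) (map_node_rem f c).
    rewrite hornerD hornerM horner_prod (bigD1 b) //= fE map_polyX hornerX.
    by rewrite hornerXsubC subrr mul0r mulr0 add0r hornerXn -exprM => ->.
  - rewrite map_inj_in_uniq ?enum_uniq // => b c _ _ /eqP.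
    rewrite (eq_prim_root_expr prim_z) !modn_small // => /eqP/val_inj.
    exact: inj_i.
  rewrite size_map -cardE card_ord; apply: leq_trans (size_sum _ _ _) _.
  apply/bigmax_leqP=> c _; apply: leq_trans (size_scale_leq _ _) _.
  exact: leq_trans (size_poly _ _) (size_node_rem c).
have : \row_c a c *m map_mx f rem_mx = 0.
  by apply/rem_mx_ker; rewrite -[RHS]v0; apply: eq_bigr => c _; rewrite mxE.
have uH : map_mx f rem_mx \in unitmx by rewrite unitmxE unitfE.
move=> /(congr1 (mulmx^~ (invmx (map_mx f rem_mx)))); rewrite mulmxK // mul0mx.
by move=> /rowP r0 c; have := r0 c; rewrite !mxE.
Qed.

End Minor.

End Chebotarev.

(** * Invariant subspaces of the regular representation of an abelian group *)

(** In characteristic 0 the polynomial ['X^n - 1] is separable, so it has [n] distinct roots. *)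
Lemma closed_prim_root (F : numClosedFieldType) n : (0 < n)%N ->
  exists z : F, n.-primitive_root z.
Proof.
move=> n_gt0; have [r Dp] := closed_field_poly_normal ('X^n - 1 : {poly F}).
rewrite (monicP _) ?monicXnsubC // scale1r in Dp.
have rn1 : all n.-unity_root r by apply/allP=> z; rewrite -root_prod_XsubC -Dp.
have sz_r : (n < (size r).+1)%N.
  by rewrite -(size_prod_XsubC r id) -Dp size_XnsubC.
have [|z] := hasP (has_prim_root n_gt0 rn1 _ sz_r); last by exists z.
rewrite -separable_prod_XsubC -Dp separable_Xn_sub_1 //.
by rewrite Num.Theory.pnatr_eq0 -lt0n.
Qed.

Lemma cyclic_log (gT : finGroupType) : cyclic [set: gT] ->
  exists (g : gT) (log : gT -> 'I_#|gT|),
    #[g]%g = #|gT| /\ forall x, x = (g ^+ log x)%g.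
Proof.
case/cyclicP=> g eg; have og : #[g]%g = #|gT| by rewrite orderE -eg cardsT.
have /choice[log logP] : forall x, exists i : 'I_#|gT|, x = (g ^+ i)%g.
  move=> x; have /cyclePmin[i lti ->] : x \in <[g]>%g by rewrite -eg inE.
  by rewrite og in lti; exists (Ordinal lti).
by exists g, log.
Qed.

Section Characters.
Variables (gT : finGroupType) (R : realType).
Local Notation C := (R[i]).
Local Notation CG := (complexGA gT R).
Implicit Types (L U : {vspace CG}) (w : CG) (g h x y : gT).

Definition regact_stable L := forall h w, w \in L -> (regact h w : CG) \in L.

Definition is_char w := w 1%g = 1 /\ forall x y, w (x * y)%g = w x * w y.

Lemma regactM g h w : regact g (regact h w) = regact (g * h)%g w.
Proof. by apply/ffunP=> x; rewrite !ffunE invMg mulgA. Qed.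

Lemma regactZ g (a : C) w : regact g (a *: w) = a *: (regact g w : CG).
Proof. by apply/ffunP=> x; rewrite !ffunE. Qed.

Lemma regact_sum g (I : Type) (r : seq I) (F : I -> CG) :
  regact g (\sum_(i <- r) F i) = \sum_(i <- r) (regact g (F i) : CG).
Proof.
apply/ffunP=> x; rewrite ffunE !sum_ffunE.
by apply: eq_bigr => i _; rewrite ffunE.
Qed.

Lemma regact1 w : regact 1%g w = w.
Proof. by apply/ffunP=> x; rewrite ffunE invg1 mul1g. Qed.

Lemma span_char_invariant d (X : d.-tuple CG) :
  (forall i : 'I_d, is_char X`_i) -> regact_stable <<X>>%VS.
Proof.
move=> chX h w /coord_span ->; rewrite regact_sum rpred_sum // => i _.
rewrite regactZ rpredZ //.
have -> : (regact h X`_i : CG) = X`_i h^-1%g *: X`_i.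
  by apply/ffunP=> x; rewrite !ffunE (chX i).2.
by rewrite rpredZ // memv_span // mem_nth // size_tuple.
Qed.

(** The one hypothesis gives both the bound on zeros and freeness, since the zero vector has
    [#|gT|], hence at least [d], zeros. *)
Lemma trop_span_uniform d (X : d.-tuple CG) : (d <= #|gT|)%N ->
    (forall k : 'I_d -> C, (d <= #|zeros (\sum_i k i *: X`_i)|)%N ->
      forall i, k i = 0) ->
  trop <<X>>%VS = trop_linspace (uniform_matroid d gT).
Proof.
move=> led kX; apply: trop_uniform => //.
  have /eqP -> : free X.
    apply/freeP => k k0; apply: kX; rewrite k0.
    suff -> : zeros (0 : CG) = [set: gT] by rewrite cardsT.
    by apply/setP=> x; rewrite !inE ffunE eqxx.
  by rewrite size_tuple.
move=> w /coord_span ew; apply: contraNltn; rewrite ew => /kX k0.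
by rewrite big1 // => i _; rewrite k0 scale0r.
Qed.

Section Split.
Variables (n : nat) (z : C) (g : gT) (w : CG).
Hypotheses (prim_z : n.-primitive_root z) (gn1 : (g ^+ n = 1)%g).

(** Up to the factor [n], the projection of [w] onto the eigenspace of [g] with eigenvalue
    [z ^- j]. *)
Definition isotypic (j : nat) : CG :=
  \sum_(k < n) z ^+ (j * k) *: (regact (g ^+ k)%g w : CG).

Lemma regact_isotypic j : isotypic j = z ^+ j *: (regact g (isotypic j) : CG).
Proof.
pose F k : CG := z ^+ (j * k) *: (regact (g ^+ k)%g w : CG).
have eF : z ^+ j *: (regact g (isotypic j) : CG) = \sum_(k < n) F k.+1.
  rewrite regact_sum scaler_sumr; apply: eq_bigr => k _.
  by rewrite /F regactZ regactM scalerA -exprD -expgS mulnS.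
have F0 : F n = F 0.
  rewrite /F gn1 expg0 muln0 mulnC exprM (prim_expr_order prim_z).
  by rewrite expr1n.
rewrite eF; apply: (addIr (F 0)); rewrite -{1}F0 /isotypic -/(F _).
rewrite -(big_ord_recr n (fun k => F k)) /= big_ord_recl addrC.
by congr (_ + _); apply: eq_bigr.
Qed.

Lemma sum_isotypic : \sum_(j < n) isotypic j = n%:R *: w.
Proof.
rewrite exchange_big /=; have := prim_order_gt0 prim_z.
case: n prim_z => // m prim_z' _; rewrite big_ord_recl [X in _ + X]big1 => [|k _].
  rewrite addr0; under eq_bigr do rewrite muln0 expr0 expg0 regact1 scale1r.
  by rewrite sumr_const card_ord scaler_nat.
rewrite -scaler_suml.
suff -> : \sum_(j < m.+1) z ^+ (j * lift ord0 k) = 0 by rewrite scale0r.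
have nz1 : z ^+ (lift ord0 k) != 1.
  by rewrite -(prim_order_dvd prim_z') gtnNdvd // ltn_ord.
under eq_bigr do rewrite mulnC exprM.
apply/eqP; have := subrX1 (z ^+ lift ord0 k) m.+1.
rewrite exprAC (prim_expr_order prim_z') expr1n subrr => /esym/eqP.
by rewrite mulf_eq0 subr_eq0 (negPf nz1).
Qed.

End Split.

(** Induction on the elements of which [w] is not yet known to be an eigenvector: splitting [w] into
    isotypic parts for [g] settles [g], and commutativity keeps the earlier eigenvalues. A common
    eigenvector is a multiple of a character. *)
Lemma characters_span L U : abelian [set: gT] -> regact_stable L ->
  (forall w, w \in L -> is_char w -> w \in U) -> (L <= U)%VS.
Proof.
move=> abG invL chU.
pose eig (s : seq gT) w :=
  {in s, forall g, exists a : C, regact g w = a *: w}.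
have commG x y : (x * y = y * x)%g.
  by have /centsP/(_ x (in_setT x) y (in_setT y)) := abG.
pose P s := forall w, w \in L -> eig s w -> w \in U.
have n_gt0 : (0 < #|gT|)%N by rewrite -cardsT cardG_gt0.
have Pall : P (enum gT).
  move=> w wL eigw.
  have wM x : exists a : C, forall y, w (x * y)%g = a * w y.
    have [|a ea] := eigw x^-1%g; first by rewrite mem_enum.
    exists a => y; have /ffunP/(_ y) := ea.
    by rewrite !ffunE invgK.
  have [w1 | nzw1] := eqVneq (w 1%g) 0.
    suff -> : w = 0 by rewrite mem0v.
    apply/ffunP=> x; have [a wx] := wM x.
    by rewrite -[x]mulg1 wx w1 mulr0 ffunE.
  have -> : w = w 1%g *: ((w 1%g)^-1 *: w) by rewrite scalerA divff // scale1r.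
  apply/rpredZ/chU; first exact: rpredZ.
  split=> [|x y]; rewrite !ffunE /=; first exact: mulVf.
  have [a wx] := wM x; rewrite wx -[in w x](mulg1 x) wx.
  rewrite /GRing.scale /= mulrCA [in RHS](mulrCA _ a) mulVf // mulr1.
  by rewrite mulrCA.
have Pcons g s : P (g :: s) -> P s.
  move=> Pgs w wL eigw; have [z prim_z] := @closed_prim_root C #|gT| n_gt0.
  have gn1 : (g ^+ #|gT| = 1)%g by rewrite -cardsT expg_cardG ?inE.
  have nzn : #|gT|%:R != 0 :> C by rewrite Num.Theory.pnatr_eq0 -lt0n.
  suff : #|gT|%:R *: w \in U.
    by move/(rpredZ (#|gT|%:R^-1 : C)); rewrite scalerA mulVf // scale1r.
  rewrite -(sum_isotypic g w prim_z); apply: rpred_sum => j _; apply: Pgs.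
    by apply: rpred_sum => k _; apply/rpredZ/invL.
  move=> h; rewrite inE => /predU1P[-> | hs].
    exists (z ^- j); rewrite [in RHS](regact_isotypic w prim_z gn1 j).
    rewrite scalerA mulVf ?scale1r // expf_neq0 //.
    apply: contra_eq_neq (prim_expr_order prim_z) => ->.
    by rewrite expr0n gtn_eqF // eq_sym oner_neq0.
  have [a ha] := eigw h hs; exists a.
  rewrite regact_sum scaler_sumr; apply: eq_bigr => k _.
  by rewrite regactZ regactM commG -regactM ha regactZ !scalerA mulrC.
suff P0 : P [::] by apply/subvP=> w wL; apply: P0.
have Pcat s t : P (s ++ t) -> P t by elim: s => // g s IHs /Pcons.
by apply: (Pcat (enum gT)); rewrite cats0.
Qed.

End Characters.

(** * Powers of a faithful character, and the cyclic and prime cases *)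

Section Realizable.
Variables (gT : finGroupType) (R : realType).
Local Notation C := (R[i]).
Local Notation CG := (complexGA gT R).
Implicit Types (L : {vspace CG}) (w : CG).

Definition pow_char (z : C) (log : gT -> 'I_#|gT|) (j : nat) : CG :=
  [ffun x => z ^+ (j * log x)].

Section Cyclic.
Variables (z : C) (g : gT) (log : gT -> 'I_#|gT|).
Hypotheses (prim_z : #|gT|.-primitive_root z) (og : #[g]%g = #|gT|)
           (logP : forall x, x = (g ^+ log x)%g).

Lemma log_inj : injective log.
Proof. by move=> x y e; rewrite (logP x) e -logP. Qed.

Lemma pow_charP j : is_char (pow_char z log j).
Proof.
have logM x y : z ^+ log (x * y)%g = z ^+ (log x + log y).
  have : (g ^+ log (x * y)%g == g ^+ (log x + log y))%g.
    by rewrite expgD -!logP.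
  by rewrite eq_expg_mod_order og -(eq_prim_root_expr prim_z) => /eqP.
split=> [|x y]; rewrite !ffunE; last first.
  by rewrite -exprD -mulnDr mulnC exprM logM -exprM mulnC.
have e1 : z ^+ log 1%g = 1.
  have : (#[g]%g %| log 1%g)%N by rewrite order_dvdn -logP.
  by rewrite og (prim_order_dvd prim_z) => /eqP.
by rewrite mulnC exprM e1 expr1n.
Qed.

(** A character is determined by its value at the generator, an [n]-th root of unity with
    [n = #|gT|], hence a power of [z]. *)
Lemma pow_charE w : is_char w -> exists j : 'I_#|gT|, w = pow_char z log j.
Proof.
case=> w1 wM; have wX x n : w (x ^+ n)%g = w x ^+ n.
  by elim: n => [|n IHn]; rewrite ?expg0 // expgS wM IHn exprS.
have [|j ej] := prim_rootP prim_z (_ : w g ^+ #|gT| = 1).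
  by rewrite -wX -og expg_order.
exists j; apply/ffunP=> x; rewrite ffunE {1}(logP x) wX exprM; congr (_ ^+ _).
exact: ej.
Qed.

Lemma realizable_uniform_cyclic d : (d <= #|gT|)%N ->
  realizable R (trop_linspace (uniform_matroid d gT)).
Proof.
move=> led; pose X := [tuple pow_char z log i | i < d].
have X_ (i : 'I_d) : X`_i = pow_char z log i.
  by rewrite -tnth_nth tnth_mktuple.
exists <<X>>%VS; split.
  by apply: span_char_invariant => i; rewrite X_; apply: pow_charP.
rewrite (@trop_span_uniform _ _ d) // => k.
set w := \sum_i _ => led0 i.
pose P : {poly C} := \sum_(i < d) k i *: 'X^i.
suff P0 : P = 0.
  have /polyP/(_ i) := P0; rewrite coef_sum coef0 (bigD1 i) //= big1 => [|c neq_ci].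
    by rewrite coefZ coefXn eqxx mulr1 addr0.
  by rewrite coefZ coefXn (inj_eq val_inj) eq_sym (negPf neq_ci) mulr0.
(* The value of [w] at [x] is that of [P] at [z ^+ log x], and these points are distinct. *)
apply: (@roots_geq_poly_eq0 _ _ [seq z ^+ log x | x <- enum (zeros w)]).
- apply/allP=> _ /mapP[x + ->]; rewrite mem_enum inE => /eqP wx0.
  rewrite /root horner_sum -[X in _ == X]wx0 /w sum_ffunE; apply/eqP/eq_bigr=> c _.
  by rewrite hornerZ hornerXn !ffunE X_ ffunE -exprM mulnC.
- rewrite map_inj_in_uniq ?enum_uniq // => x y _ _ /eqP.
  rewrite (eq_prim_root_expr prim_z) !modn_small // => /eqP/val_inj.
  exact: log_inj.
rewrite size_map -cardE; apply: leq_trans led0; apply: leq_trans (size_sum _ _ _) _.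
apply/bigmax_leqP=> c _; apply: leq_trans (size_scale_leq _ _) _.
by rewrite size_polyXn.
Qed.

Lemma trop_invariant_prime L : prime #|gT| -> regact_stable L ->
  exists2 k, (k <= #|gT|)%N & trop L = trop_linspace (uniform_matroid k gT).
Proof.
move=> p_pr invL.
have abG : abelian [set: gT] by rewrite cyclic_abelian // prime_cyclic // cardsT.
pose S := [set j : 'I_#|gT| | pow_char z log j \in L].
have leS : (#|S| <= #|gT|)%N by rewrite -[X in (_ <= X)%N]card_ord max_card.
pose X := [tuple pow_char z log (enum_val i) | i < #|S|].
have X_ (i : 'I_#|S|) : X`_i = pow_char z log (enum_val i).
  by rewrite -tnth_nth tnth_mktuple.
exists #|S| => //; rewrite -(@trop_span_uniform _ _ _ X) //.
  congr trop; apply/eqP; rewrite eqEsubv; apply/andP; split.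
    apply: characters_span => // w wL /pow_charE[j ew].
    have jS : j \in S by rewrite inE -ew.
    rewrite ew -(enum_rankK_in jS jS) -X_.
    by rewrite memv_span // mem_nth // size_tuple.
  apply/span_subvP=> _ /mapP[i _ ->].
  by have := enum_valP i; rewrite inE.
move=> a lek.
(* As many zeros as there are characters in [L] give the rows of a square Fourier minor with columns
   [S]. *)
have [I sI cI] := subset_of_card lek.
pose row (b : 'I_#|S|) : gT := enum_val (cast_ord (esym cI) b).
have rowI b : row b \in I by apply: enum_valP.
have inj_row : injective (log \o row).
  by move=> b c /log_inj/enum_val_inj/cast_ord_inj.
apply: (chebotarev p_pr inj_row (@enum_val_inj _ S) prim_z) => b.
have := subsetP sI _ (rowI b); rewrite inE sum_ffunE => /eqP wx0.
rewrite -[RHS]wx0; apply: eq_bigr => c _.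
by rewrite !ffunE X_ ffunE mulnC.
Qed.

End Cyclic.

Lemma cyclic_realizable d : cyclic [set: gT] -> (d <= #|gT|)%N ->
  realizable R (trop_linspace (uniform_matroid d gT)).
Proof.
case/cyclic_log=> g [log [og logP]].
have n_gt0 : (0 < #|gT|)%N by rewrite -cardsT cardG_gt0.
have [z prim_z] := @closed_prim_root C _ n_gt0.
exact: realizable_uniform_cyclic prim_z og logP d.
Qed.

Lemma realizable_prime_uniform d T : prime #|gT| ->
  trop_rep d T -> realizable R T ->
  T = trop_linspace (uniform_matroid d gT).
Proof.
move=> p_pr [[M rM ->] _] [L [invL eT]].
have cycG : cyclic [set: gT] by rewrite prime_cyclic // cardsT.
have [g [log [og logP]]] := cyclic_log cycG.
have [z prim_z] := @closed_prim_root C _ (prime_gt0 p_pr).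
have [k lek eL] := trop_invariant_prime prim_z og logP p_pr invL.
have /trop_linspace_eq/eq_mrank := etrans eT eL.
by rewrite mrank_uniform (minn_idPl lek) rM => ->; rewrite eT.
Qed.

Lemma realizable2_cyclic : abelian [set: gT] -> (2 <= #|gT|)%N ->
  realizable R (trop_linspace (uniform_matroid 2 gT)) -> cyclic [set: gT].
Proof.
move=> abG le2n [L [invL eL]].
(* A vector of [L] vanishing exactly at 1 shows that [L] lies in no line spanned by a character, as
   characters take the value 1 there. *)
have [|w0 w0L zw0] := trop_uniform_support le2n (esym eL) (_ : #|~: [set 1%g]| = _).
  by rewrite cardsCs setCK cards1 -(subnSK le2n).
rewrite setCK in zw0.
have nz0 : w0 != 0.
  apply: contraTneq le2n => w00; have /setP/(_ _) z1 := zw0.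
  have : #|zeros w0| = 1%N by rewrite zw0 cards1.
  have -> : zeros w0 = [set: gT].
    by apply/setP=> x; rewrite w00 !inE ffunE eqxx.
  by rewrite cardsT => ->.
have ex_char v : ~~ (L <= <[v]>)%VS ->
    exists w, [/\ w \in L, is_char w & w \notin <[v]>%VS].
  move=> NLv; apply: contrapT => no; case/negP: NLv.
  apply: characters_span => // w wL chw; apply: contrapT => /negP Nw.
  by case: no; exists w.
have [|u [uL [u1 uM] nzu]] := ex_char 0.
  by apply: contra nz0 => /subvP/(_ w0 w0L)/vlineP[a ->]; rewrite scaler0.
have [|v [vL [v1 vM] Nuv]] := ex_char u.
  apply: contra nz0 => /subvP/(_ w0 w0L)/vlineP[a ea].
  have := set11 (1%g : gT); rewrite -zw0 inE ea ffunE u1 [a *: 1]mulr1.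
  by move/eqP->; rewrite scale0r.
have nz_vu : v - u != 0.
  by apply: contraNneq Nuv => /subr0_eq ->; rewrite memv_line.
have vuL : v - u \in L by apply: rpredB.
have nzu_at x : u x != 0.
  by apply/eqP => ux0; have /eqP := u1; rewrite -(mulgV x) uM ux0 mul0r eq_sym oner_eq0.
(* The quotient [v / u] is multiplicative; a kernel element other than 1 would give [v - u] two
   zeros, more than rank two allows. *)
apply: (@field_mul_group_cyclic _ [set: gT]%G C (fun x => v x / u x)).
  by move=> x y _ _; rewrite vM uM invfM mulrACA.
move=> x _; split=> [e | ->]; last by rewrite v1 u1 divr1.
apply: contrapT => /eqP neq_x1.
have := trop_uniform_zeros le2n (esym eL) vuL nz_vu.
rewrite ltnNge => /negP[].
suff : (#|[set x; 1%g]| <= #|zeros (v - u)|)%N by rewrite cards2 neq_x1.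
apply: subset_leq_card; apply/subsetP=> y; rewrite !inE => /orP[]/eqP->.
  by rewrite !ffunE -(divfK (nzu_at x) (v x)) e mul1r subrr.
by rewrite !ffunE v1 u1 subrr.
Qed.

End Realizable.

Theorem theorem2 (R : realType) (gT : finGroupType) :
  (forall M : matroid gT,
     trop_rep (mrank M) (trop_linspace M) <->
     forall h : gT, matroid_aut M (fun g => (h * g)%g))
  /\ (forall d : nat, (1 <= d <= #|gT|)%N ->
        trop_rep d (trop_linspace (uniform_matroid d gT)))
  /\ ((forall T : set (boolmod gT),
         trop_rep 1 T <-> T = trop_linspace (uniform_matroid 1 gT))
      /\ (forall T : set (boolmod gT),
            trop_rep #|gT|.-1 T <->
            T = trop_linspace (uniform_matroid #|gT|.-1 gT))
      /\ realizable R (trop_linspace (uniform_matroid 1 gT))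
      /\ realizable R (trop_linspace (uniform_matroid #|gT|.-1 gT)))
  /\ (abelian [set: gT] -> (2 <= #|gT|)%N ->
      cyclic [set: gT] <->
      realizable R (trop_linspace (uniform_matroid 2 gT)))
  /\ (forall p : nat, prime p -> [set: gT] \isog [set: 'Z_p] ->
        (forall d : nat, (1 <= d <= p)%N ->
           realizable R (trop_linspace (uniform_matroid d gT)))
        /\ (forall (d : nat) (T : set (boolmod gT)), (1 <= d)%N ->
              trop_rep d T -> realizable R T ->
              T = trop_linspace (uniform_matroid d gT)))
  /\ (forall (p : nat) (u : {unit 'Z_p}), prime p -> odd p ->
        val u = 2%:R ->
        generator (units_Zp p) u
        \/ (p = 7 %[mod 8])%N /\ #[u]%g = (p.-1 %/ 2)%N ->
        forall T : set (boolmod 'Z_p),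
          trop_rep 2 T <-> T = trop_linspace (uniform_matroid 2 'Z_p)).
Proof.
have card_Z p : prime p -> #|'Z_p| = p.
  by move=> p_pr; rewrite card_ord Zp_cast ?prime_gt1.
split; first exact: trop_rep_linspaceP.
split; first by move=> d /andP[_ led]; apply: trop_rep_uniform.
split.
  split; first exact: trop_rep1.
  split; first exact: trop_rep_codim1.
  by split; [apply: realizable_uniform1 | apply: realizable_uniform_codim1].
split.
  move=> abG le2n; split=> [cycG|]; first exact: cyclic_realizable.
  exact: realizable2_cyclic.
split=> [p p_pr isoG | p u p_pr _ _ _].
  have cG : #|gT| = p by rewrite -cardsT (card_isog isoG) cardsT card_Z.
  have cG_pr : prime #|gT| by rewrite cG.
  split=> [d /andP[_ led] | d T _]; last exact: realizable_prime_uniform.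
  by apply: cyclic_realizable; rewrite ?cG // prime_cyclic // cardsT.
by apply: trop_rep2_prime; rewrite card_Z.
Qed.
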